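(* Let $A$ be a commutative unitary ring. Then $A$ is a multiplication ring if and only if its residuated lattice of ideals $(\mathrm{Id}(A),\cap,+,\otimes,\rightarrow,\{0\},A)$ is divisible.
   Context: A residuated lattice is an algebra $(L,\wedge,\vee,\odot,\rightarrow,0,1)$ such that $(L,\wedge,\vee,0,1)$ is a bounded lattice with order $\leq$, $(L,\odot,1)$ is a commutative ordered monoid, and $z\leq x\rightarrow y$ iff $x\odot z\leq y$ for all $x,y,z\in L$. It is divisible if $x\odot(x\rightarrow y)=x\wedge y$ for all $x,y\in L$. For a commutative unitary ring $A$, $\mathrm{Id}(A)$ is the set of ideals of $A$. Ordered by inclusion, it is a residuated lattice with meet $I\cap J$, join $I+J=\{i+j: i\in I, j\in J\}$, product $I\otimes J=\{\sum_{k=1}^n i_kj_k : i_k\in I, j_k\in J\}$, residuum $I\rightarrow J=(J:I)=\{x\in A: xI\subseteq J\}$, least element $\{0\}$ and greatest element $A$ (the unit of $\otimes$). An ideal $I$ of $A$ is a multiplication ideal if for every ideal $J\subseteq I$ there exists an ideal $K$ of $A$ such that $J=I\otimes K$. The ring $A$ is a multiplication ring if all its ideals are multiplication ideals. *)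

(* Defs.v *)
From HB Require Import structures.
From mathcomp Require Import all_boot all_order all_algebra.
From mathcomp Require Import boolp.

Set Implicit Arguments.
Unset Strict Implicit.
Unset Printing Implicit Defensive.

Import Order.TTheory GRing.Theory.
Local Open Scope ring_scope.

(* The unit of the monoid is the top element, and no distinctness of bottom
   and top is required. *)
HB.mixin Record isResiduated d T of Order.TBLattice d T := {
  rprod : T -> T -> T;
  rimpl : T -> T -> T;
  rprodA : associative rprod;
  rprodC : commutative rprod;
  rprod1x : left_id (\top%O : T) rprod;
  rprod_le : forall x y z : T, (x <= y)%O -> (rprod x z <= rprod y z)%O;
  rimplP : forall x y z : T, (z <= rimpl x y)%O = (rprod x z <= y)%O
}.

#[short(type="residuatedLatticeType")]
HB.structure Definition ResiduatedLattice d :=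
  { T of Order.TBLattice d T & isResiduated d T }.

Definition divisible d (L : residuatedLatticeType d) : Prop :=
  forall x y : L, rprod x (rimpl x y) = Order.meet x y.

(* MathComp's [idealr_closed] only covers boolean and proper ideals, hence this
   definition. The zero ring is allowed. *)
Record is_ideal (A : comPzRingType) (P : A -> Prop) : Prop := IsIdeal {
  is_ideal0 : P 0;
  is_idealD : forall x y, P x -> P y -> P (x + y);
  is_idealMl : forall a x, P x -> P (a * x)
}.

Record ideal (A : comPzRingType) := Ideal {
  ideal_mem :> A -> Prop;
  ideal_memP : is_ideal ideal_mem
}.

HB.instance Definition _ A := gen_eqMixin (ideal A).
HB.instance Definition _ A := gen_choiceMixin (ideal A).

Section IdealOps.
Variable A : comPzRingType.
Implicit Types (I J K : ideal A) (x y z a : A).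

Lemma ideal_ext I J : (forall x, I x <-> J x) -> I = J.
Proof.
case: I J => [P HP] [Q HQ] /= PQ.
have E : P = Q by apply/funext => x; apply/propext.
by case: _ / E HQ {PQ} => HQ; congr Ideal; exact: Prop_irrelevance.
Qed.

Lemma ideal0 I : I 0. Proof. exact: is_ideal0 (ideal_memP I). Qed.

Lemma idealD I x y : I x -> I y -> I (x + y).
Proof. exact: is_idealD (ideal_memP I) _ _. Qed.

Lemma idealMl I a x : I x -> I (a * x).
Proof. exact: is_idealMl (ideal_memP I) _ _. Qed.

Lemma idealMr I a x : I x -> I (x * a).
Proof. by rewrite mulrC; exact: idealMl. Qed.

Lemma ideal_sum I n (f : 'I_n -> A) :
  (forall k, I (f k)) -> I (\sum_(k < n) f k).
Proof.
by move=> If; apply: big_ind => //; [exact: ideal0 | exact: idealD].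
Qed.

Lemma zero_is_ideal : is_ideal (fun x : A => x = 0).
Proof. by split=> // [x y -> ->|a x ->]; rewrite ?addr0 ?mulr0. Qed.
Definition zero_ideal := Ideal zero_is_ideal.

Lemma full_is_ideal : is_ideal (fun _ : A => True).
Proof. by []. Qed.
Definition full_ideal := Ideal full_is_ideal.

Lemma inter_is_ideal I J : is_ideal (fun x => I x /\ J x).
Proof.
split=> [|x y [? ?] [? ?]|a x [? ?]]; split;
  by [exact: ideal0 | exact: idealD | exact: idealMl].
Qed.
Definition ideal_inter I J := Ideal (inter_is_ideal I J).

Lemma sum_is_ideal I J :
  is_ideal (fun x => exists i j, [/\ I i, J j & x = i + j]).
Proof.
split=> [|x y [i [j [Ii Jj ->]]] [i' [j' [Ii' Jj' ->]]]|a x [i [j [Ii Jj ->]]]].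
- by exists 0, 0; rewrite addr0; split => //; exact: ideal0.
- by exists (i + i'), (j + j'); rewrite addrACA; split => //; exact: idealD.
- by exists (a * i), (a * j); rewrite mulrDr; split => //; exact: idealMl.
Qed.
Definition ideal_add I J := Ideal (sum_is_ideal I J).

Lemma prod_is_ideal I J :
  is_ideal (fun x => exists n (i j : 'I_n -> A),
    [/\ forall k, I (i k), forall k, J (j k) & x = \sum_(k < n) i k * j k]).
Proof.
split.
- exists 0%N, (fun=> 0), (fun=> 0).
  by rewrite big_ord0; split => // k; exact: ideal0.
- move=> x y [n [i [j [Ii Jj ->]]]] [m [i' [j' [Ii' Jj' ->]]]].
  pose glue (f : 'I_n -> A) (g : 'I_m -> A) (k : 'I_(n + m)) :=
    match split k with inl u => f u | inr v => g v end.
  exists (n + m)%N, (glue i i'), (glue j j'); split.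
  + by move=> k; rewrite /glue; case: split.
  + by move=> k; rewrite /glue; case: split.
  + rewrite big_split_ord /=; congr (_ + _); apply: eq_bigr => k _.
      by rewrite /glue (unsplitK (inl k)).
    by rewrite /glue (unsplitK (inr k)).
- move=> a x [n [i [j [Ii Jj ->]]]].
  exists n, (fun k => a * i k), j; split => // [k|]; first exact: idealMl.
  by rewrite mulr_sumr; apply: eq_bigr => k _; rewrite mulrA.
Qed.
Definition ideal_mul I J := Ideal (prod_is_ideal I J).

Lemma residual_is_ideal I J : is_ideal (fun x => forall y, I y -> J (x * y)).
Proof.
split=> [y _|x x' Hx Hx' y Iy|a x Hx y Iy].
- by rewrite mul0r; exact: ideal0.
- by rewrite mulrDl; apply: idealD; auto.
- by rewrite -mulrA; apply: idealMl; auto.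
Qed.
Definition ideal_residual I J := Ideal (residual_is_ideal I J).

Definition ideal_le I J : bool := `[< forall x, I x -> J x >].

Lemma ideal_leP I J : reflect (forall x, I x -> J x) (ideal_le I J).
Proof. exact: asboolP. Qed.

Lemma ideal_le_refl : reflexive ideal_le.
Proof. by move=> I; apply/ideal_leP. Qed.

Lemma ideal_le_anti : antisymmetric ideal_le.
Proof.
move=> I J /andP[/ideal_leP IJ /ideal_leP JI].
by apply: ideal_ext => x; split; auto.
Qed.

Lemma ideal_le_trans : transitive ideal_le.
Proof.
by move=> J I K /ideal_leP IJ /ideal_leP JK; apply/ideal_leP => x /IJ /JK.
Qed.

Lemma ideal_interP I J K :
  ideal_le I (ideal_inter J K) = ideal_le I J && ideal_le I K.
Proof.
apply/ideal_leP/andP => [H|[/ideal_leP IJ /ideal_leP IK] x Ix].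
  by split; apply/ideal_leP => x /H [].
by split; auto.
Qed.

Lemma ideal_addP I J K :
  ideal_le (ideal_add I J) K = ideal_le I K && ideal_le J K.
Proof.
apply/ideal_leP/andP => [H|[/ideal_leP IK /ideal_leP JK] x [i [j [Ii Jj ->]]]].
  split; apply/ideal_leP => x Hx; apply: H.
    by exists x, 0; rewrite addr0; split => //; exact: ideal0.
  by exists 0, x; rewrite add0r; split => //; exact: ideal0.
by apply: idealD; auto.
Qed.

Lemma zero_ideal_le I : ideal_le zero_ideal I.
Proof. by apply/ideal_leP => x ->; exact: ideal0. Qed.

Lemma ideal_le_full I : ideal_le I full_ideal.
Proof. exact/ideal_leP. Qed.

Lemma mem_ideal_mul I J x y : I x -> J y -> ideal_mul I J (x * y).
Proof. by move=> Ix Jy; exists 1%N, (fun=> x), (fun=> y); rewrite big_ord1. Qed.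

Lemma ideal_mul_leP I J K :
  reflect (forall x y, I x -> J y -> K (x * y)) (ideal_le (ideal_mul I J) K).
Proof.
apply: (iffP (ideal_leP _ _)) => [H x y Ix Jy | H x [n [i [j [Ii Jj ->]]]]].
  by apply: H; exact: mem_ideal_mul.
by apply: ideal_sum => k; auto.
Qed.

Lemma ideal_mulC : commutative ideal_mul.
Proof.
move=> I J; apply: ideal_le_anti; apply/andP; split; apply/ideal_mul_leP => x y *;
  by rewrite mulrC; exact: mem_ideal_mul.
Qed.

Lemma ideal_residualP I J K :
  ideal_le K (ideal_residual I J) = ideal_le (ideal_mul I K) J.
Proof.
apply/ideal_leP/idP => [H|/ideal_mul_leP H x Kx y Iy].
  by apply/ideal_mul_leP => x y Ix Ky; rewrite mulrC; exact: H Ky _ Ix.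
by rewrite mulrC; exact: H.
Qed.

Lemma ideal_mul_mono I J K :
  ideal_le I J -> ideal_le (ideal_mul I K) (ideal_mul J K).
Proof.
move=> /ideal_leP IJ; apply/ideal_mul_leP => x y Ix Ky.
by apply: mem_ideal_mul => //; exact: IJ.
Qed.

Lemma ideal_mulA_le I J K :
  ideal_le (ideal_mul I (ideal_mul J K)) (ideal_mul (ideal_mul I J) K).
Proof.
apply/ideal_mul_leP => x _ Ix [n [j [k [Jj Kk ->]]]].
rewrite mulr_sumr; apply: ideal_sum => l; rewrite mulrA.
by apply: mem_ideal_mul => //; exact: mem_ideal_mul.
Qed.

Lemma ideal_mulA : associative ideal_mul.
Proof.
move=> I J K; apply: ideal_le_anti; rewrite ideal_mulA_le /=.
rewrite (ideal_mulC _ K) (ideal_mulC I J) (ideal_mulC I) (ideal_mulC J K).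
exact: ideal_mulA_le.
Qed.

Lemma ideal_mul1 : left_id full_ideal ideal_mul.
Proof.
move=> I; apply: ideal_le_anti; apply/andP; split.
  by apply/ideal_mul_leP => x y _; exact: idealMl.
by apply/ideal_leP => x Ix; rewrite -[x]mul1r; exact: mem_ideal_mul.
Qed.

End IdealOps.

Fact ideal_display : Order.disp_t. Proof. exact: Order.Disp tt tt. Qed.

HB.instance Definition _ (A : comPzRingType) :=
  Order.Le_isPOrder.Build ideal_display (ideal A)
    (@ideal_le_refl A) (@ideal_le_anti A) (@ideal_le_trans A).
HB.instance Definition _ (A : comPzRingType) :=
  Order.POrder_MeetJoin_isLattice.Build ideal_display (ideal A)
    (@ideal_interP A) (@ideal_addP A).
HB.instance Definition _ (A : comPzRingType) :=
  Order.hasBottom.Build ideal_display (ideal A) (@zero_ideal_le A).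
HB.instance Definition _ (A : comPzRingType) :=
  Order.hasTop.Build ideal_display (ideal A) (@ideal_le_full A).
HB.instance Definition _ (A : comPzRingType) :=
  isResiduated.Build ideal_display (ideal A)
    (@ideal_mulA A) (@ideal_mulC A) (@ideal_mul1 A)
    (fun I J K => @ideal_mul_mono A I J K)
    (@ideal_residualP A).

Definition multiplication_ideal (A : comPzRingType) (I : ideal A) : Prop :=
  forall J : ideal A, (forall x, J x -> I x) ->
    exists K : ideal A, J = ideal_mul I K.

Definition multiplication_ring (A : comPzRingType) : Prop :=
  forall I : ideal A, multiplication_ideal I.

(* Main.v *)
Require Import Defs.
From mathcomp Require Import all_boot all_order all_algebra.

(** For ideals, to contain is to divide exactly when the ring is a
    multiplication ring.  The theorem holds because divisibility of any
    residuated lattice has the same meaning: [y <= x] forces [y = x * z] for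
    some [z] (lemma [divisible_factorP]).  The residual [x -> y] is the largest
    [z] with [x * z <= y], so if [x /\ y] is a multiple of [x] at all, then it
    is already the multiple by [x -> y]. *)

Import Order.TTheory.
Local Open Scope order_scope.

Section ResiduatedLatticeTheory.
Context {d : Order.disp_t} {L : residuatedLatticeType d}.
Implicit Types x y z : L.

Lemma rprod_le2l x y z : y <= z -> rprod x y <= rprod x z.
Proof. by move=> le_yz; rewrite !(rprodC x) rprod_le. Qed.

Lemma rprod_lel x y : rprod x y <= x.
Proof. by rewrite rprodC -[leRHS]rprod1x rprod_le ?lex1. Qed.

Lemma rprod_rimpl_le x y : rprod x (rimpl x y) <= Order.meet x y.
Proof. by rewrite lexI rprod_lel -rimplP lexx. Qed.

(** Divisibility provides the factor [rimpl x y]; conversely every [z] with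
    [rprod x z = Order.meet x y] lies below [rimpl x y], so monotonicity gives
    the inequality that can fail in a general residuated lattice. *)
Lemma divisible_factorP :
  divisible L <-> forall x y, y <= x -> exists z, y = rprod x z.
Proof.
split=> [divL x y le_yx | factorL x y].
  by exists (rimpl x y); rewrite divL; apply/esym/meet_r.
apply/le_anti; rewrite rprod_rimpl_le /=.
have [z defz] := factorL x (Order.meet x y) (leIl x y).
by rewrite defz rprod_le2l // rimplP -defz leIr.
Qed.

End ResiduatedLatticeTheory.

Theorem theorem8 (A : comPzRingType) :
  multiplication_ring A <-> divisible (ideal A).
Proof.
rewrite divisible_factorP.
split=> mulA I J; first by move=> /ideal_leP; exact: mulA.
by move=> /ideal_leP; exact: mulA.
Qed.
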